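(* Let $G$ be a graph and let $c$ be a vertex of $G$ with exactly two neighbors $a$ and $b$. If $ab\in E(G)$ and $\operatorname{mmw}(G)\ge 3$, then $\operatorname{mmw}(G\setminus ab)\ge 3$.
   Context: All graphs are finite and simple; $G\setminus ab$ denotes $G$ with the edge $ab$ deleted. $\operatorname{mmw}(G)$ is the maximum matching width: the minimum, over branch-decompositions $(T,\mathcal{L})$ of $V(G)$ (with $T$ a tree all of whose vertices have degree $1$ or $3$ and $\mathcal{L}$ a bijection from its leaves to $V(G)$), of the maximum over edges $e$ of $T$ of the size of a maximum matching in $G$ among edges crossing the vertex partition induced by $e$. *)

(* Defs.v *)
From mathcomp Require Import all_boot.
From mathcomp Require Import boolp.

Set Implicit Arguments.
Unset Strict Implicit.
Unset Printing Implicit Defensive.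

Record sgraph := SGraph {
  vertex :> finType;
  adj : rel vertex;
  adj_sym : symmetric adj;
  adj_irr : irreflexive adj }.

Definition neigh (G : sgraph) (x : G) : {set G} := [set y | adj x y].

Definition degree (G : sgraph) (x : G) : nat := #|neigh x|.

Definition edges (G : sgraph) : {set {set G}} :=
  [set [set p.1; p.2] | p in [set p : G * G | adj p.1 p.2]].

Section DelEdge.
Variables (G : sgraph) (a b : G).

Definition del_adj : rel G :=
  fun x y => adj x y && ([set x; y] != [set a; b]).

Lemma del_adj_sym : symmetric del_adj.
Proof. by move=> x y; rewrite /del_adj adj_sym setUC. Qed.

Lemma del_adj_irr : irreflexive del_adj.
Proof. by move=> x; rewrite /del_adj adj_irr. Qed.

Definition del_edge : sgraph := SGraph del_adj_sym del_adj_irr.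
End DelEdge.

Definition is_tree (T : sgraph) : Prop :=
  [/\ 0 < #|T|,
      forall x y : T, connect (@adj T) x y
    & forall s : seq T, 2 < size s -> ~ ucycle (@adj T) s].

Definition leaf (T : sgraph) : finType := {x : T | degree x == 1}.

Record branch_decomp (V : finType) := BranchDecomp {
  bd_tree : sgraph;
  bd_treeP : is_tree bd_tree;
  bd_deg : forall x : bd_tree, degree x = 1 \/ degree x = 3;
  bd_map : leaf bd_tree -> V;
  bd_bij : bijective bd_map }.

(* The part of V whose leaves lie in the component of u in T \ uv; the other
   part of the partition induced by uv is its complement. *)
Definition bd_side (V : finType) (D : branch_decomp V) (u v : bd_tree D) :
    {set V} :=
  [set bd_map x | x in [set x : leaf (bd_tree D) |
                          connect (@adj (del_edge u v)) u (val x)]].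

Definition is_matching (G : sgraph) (M : {set {set G}}) : bool :=
  (M \subset edges G) && trivIset M.

Definition crosses (V : finType) (A e : {set V}) : bool :=
  (e :&: A != set0) && (e :\: A != set0).

Definition max_cut_matching (G : sgraph) (A : {set G}) : nat :=
  \max_(M : {set {set G}} | is_matching M && [forall e in M, crosses A e]) #|M|.

Definition bd_width (G : sgraph) (D : branch_decomp G) : nat :=
  \max_(p : bd_tree D * bd_tree D | adj p.1 p.2)
     max_cut_matching (bd_side p.1 p.2).

Definition is_bd_width (G : sgraph) (k : nat) : Prop :=
  exists D : branch_decomp G, bd_width D = k.

(* Graphs with at most one vertex have no branch-decomposition (a one-vertex
   tree has a vertex of degree 0); their width is set to 0. *)
Definition mmw (G : sgraph) : nat :=
  if pselect (exists k, `[< is_bd_width G k >]) is left ex then ex_minn ex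
  else 0.

(* Main.v *)
Require Import Defs.
From mathcomp Require Import all_boot.
From mathcomp Require Import boolp.

Set Implicit Arguments.
Unset Strict Implicit.
Unset Printing Implicit Defensive.

(** Every cut of [G] has the same maximum matching size in [G] and in
    [G \ ab], so each branch-decomposition has the same width for both graphs.
    Indeed, suppose that a matching across a cut uses [ab], and let [c] lie on
    the side of [a]. Both neighbors of [c] are covered by [ab], so [c] is
    unmatched and [ab] can be exchanged for the crossing edge [cb]. *)

Lemma edgesP (G : sgraph) (e : {set G}) :
  reflect (exists x y, adj x y /\ e = [set x; y]) (e \in edges G).
Proof.
apply: (iffP imsetP) => [[[x y]]|[x [y [xy ->]]]].
  by rewrite inE /= => xy ->; exists x, y.
by exists (x, y); rewrite ?inE.
Qed.

Lemma edges_del_edge (G : sgraph) (a b : G) :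
  edges (del_edge a b) = edges G :\ [set a; b].
Proof.
apply/setP => e; rewrite in_setD1; apply/(@edgesP (del_edge a b))/andP.
  case=> x [y [/= /andP[xy xyNab] ->]].
  by split=> //; apply/edgesP; exists x, y.
case=> eNab /(@edgesP G)[x [y [xy eE]]].
by exists x, y; rewrite /= /del_adj xy -eE eNab.
Qed.

Lemma crosses_set2 (V : finType) (A : {set V}) (x y : V) :
  crosses A [set x; y] = ((x \in A) != (y \in A)).
Proof.
rewrite /crosses -subset0 setIUl setDUl !subUset !subset0 !negb_and.
rewrite -![_ :|: _ == _]subset0 !subUset !subset0 !negb_and.
rewrite !setI_eq0 !setD_eq0 !disjoints1 !sub1set !negbK.
by case: (x \in A); case: (y \in A).
Qed.

Section Exchange.
Variables (G : sgraph) (a b c : G) (A : {set G}) (M : {set {set G}}).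
Hypotheses (neigh_c : neigh c = [set a; b]) (matchM : is_matching M).
Hypotheses (crossM : forall e, e \in M -> crosses A e) (abM : [set a; b] \in M).

Let adj_c x : adj c x = (x == a) || (x == b).
Proof. by have /setP/(_ x) := neigh_c; rewrite !inE. Qed.

Lemma matching_exchange_same_side : (c \in A) = (a \in A) ->
  exists M', [/\ is_matching M', forall e, e \in M' -> crosses A e,
                 [set a; b] \notin M' & #|M'| = #|M|].
Proof.
move=> caA; have [/subsetP sub /trivIsetP triv] := andP matchM.
have cNa : a != c by apply/eqP => ac; have := adj_c a; rewrite eqxx {1}ac adj_irr.
have cNb : b != c.
  by apply/eqP => bc; have := adj_c b; rewrite eqxx orbT {1}bc adj_irr.
have cbNab : [set a; b] != [set c; b].
  by apply: contraNneq cNa => /setP/(_ c); rewrite !inE eqxx eq_sym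
    (eq_sym c b) (negPf cNb) orbF => ->.
(* Another edge [e] of [M] is disjoint from [ab], so it avoids [a] and [b]. If it contained [c], its
   other end [w] would be a neighbor of [c], hence [a] or [b]. *)
have disjcb e : e \in M :\ [set a; b] -> [disjoint [set c; b] & e].
  rewrite in_setD1 => /andP[eNab eM].
  have /disjoint_setI0/setP ab0 := triv _ _ eM abM eNab.
  have be : b \notin e by have := ab0 b; rewrite !inE eqxx orbT andbT => ->.
  have ae : a \notin e by have := ab0 a; rewrite !inE eqxx andbT => ->.
  rewrite -setI_eq0; apply/set0Pn => -[x /setIP[]].
  rewrite in_set2 => /orP[]/eqP->; last exact/negP.
  move=> ce; case/edgesP: (sub _ eM) => u [v [uv eE]].
  have [w cw we] : exists2 w, adj c w & w \in e.
    move: ce; rewrite eE in_set2 => /orP[]/eqP cE.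
      by exists v; rewrite ?cE // in_set2 eqxx orbT.
    by exists u; rewrite ?cE 1?adj_sym // in_set2 eqxx.
  by move: cw we; rewrite adj_c => /orP[]/eqP->; apply/negP.
(* Otherwise [cb] would be disjoint from itself. This makes the exchange preserve the size of
   [M]. *)
have cbNM : [set c; b] \notin M :\ [set a; b].
  apply/negP => /disjcb; rewrite -setI_eq0 setIid => /eqP/setP/(_ b).
  by rewrite !inE eqxx orbT.
exists ([set c; b] |: M :\ [set a; b]); split.
- apply/andP; split.
    apply/subsetP => e; rewrite in_setU1 => /orP[/eqP->|].
      by apply/edgesP; exists c, b; rewrite adj_c eqxx orbT.
    by rewrite in_setD1 => /andP[_ /sub].
  apply/trivIsetP => e f; rewrite !in_setU1.
  case/orP=> [/eqP->|eM]; case/orP=> [/eqP->|fM]; rewrite ?eqxx //.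
  + by rewrite disjcb.
  + by rewrite disjoint_sym disjcb.
  by case/setD1P: eM => _ eM; case/setD1P: fM => _; apply: triv.
- move=> e; rewrite in_setU1 => /orP[/eqP->|/setD1P[_ /crossM //]].
  (* Since [c] and [a] lie on the same side, [cb] crosses as [ab] does. *)
  by have := crossM abM; rewrite !crosses_set2 caA.
- by rewrite in_setU1 negb_or cbNab in_setD1 eqxx.
- by rewrite cardsU1 cbNM (cardsD1 [set a; b] M) abM.
Qed.

End Exchange.

Lemma max_cut_matching_del_edge (G : sgraph) (a b c : G) (A : {set G}) :
    neigh c = [set a; b] ->
  max_cut_matching A <= @max_cut_matching (del_edge a b) A.
Proof.
move=> neigh_c; apply/bigmax_leqP => M /andP[matchM /forall_inP crossM].
have [M' [matchM' crossM' abM' <-]] :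
    exists M', [/\ is_matching M', forall e, e \in M' -> crosses A e,
                   [set a; b] \notin M' & #|M'| = #|M|].
  have [abM|abM] := boolP ([set a; b] \in M); last by exists M.
  have [caA|caA] := eqVneq (c \in A) (a \in A).
    exact: matching_exchange_same_side neigh_c matchM crossM abM caA.
  (* Here [c] is not on the side of [a]; as [ab] crosses, it is on the side of [b], and the exchange
     applies with [a] and [b] swapped. *)
  rewrite setUC in neigh_c abM *.
  apply: (matching_exchange_same_side neigh_c matchM crossM abM).
  have := crossM _ abM; rewrite crosses_set2.
  by move: caA; do 3!case: (_ \in A).
(* Avoiding [ab], [M'] is a matching of the smaller graph across the same cut. *)
apply: (@leq_bigmax_cond _ _ (fun N : {set {set del_edge a b}} => #|N|) M').
apply/andP; split; last exact/forall_inP.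
case/andP: matchM' => sub triv.
by rewrite /is_matching edges_del_edge subsetD1 sub abM' triv.
Qed.

(** Both graphs have the same vertex type, so [D] decomposes both and induces the same cuts, which
    are compared one by one. *)
Lemma bd_width_del_edge (G : sgraph) (a b c : G) (D : branch_decomp G) :
    neigh c = [set a; b] ->
  bd_width D <= @bd_width (del_edge a b) D.
Proof.
move=> neigh_c; apply/bigmax_leqP => p adj_p.
apply: leq_trans (max_cut_matching_del_edge _ neigh_c) _.
exact: (@leq_bigmax_cond _ _ (fun p : bd_tree D * bd_tree D =>
  @max_cut_matching (del_edge a b) (bd_side p.1 p.2)) p).
Qed.

Lemma mmw_le_width (G : sgraph) (D : branch_decomp G) : mmw G <= bd_width D.
Proof.
rewrite /mmw; case: pselect => // ex; case: ex_minnP => k _; apply.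
by apply/asboolP; exists D.
Qed.

(** The given [D] rules out the default value 0 of [mmw], which need not be a width. *)
Lemma mmw_attained (G : sgraph) (D : branch_decomp G) :
  exists D' : branch_decomp G, bd_width D' = mmw G.
Proof.
rewrite /mmw; case: pselect => [ex|[]]; last first.
  by exists (bd_width D); apply/asboolP; exists D.
by case: ex_minnP => k /asboolP.
Qed.

Theorem lemma3p5 (G : sgraph) (a b c : G)
    (neq_ab : a != b) (neigh_c : neigh c = [set a; b]) (adj_ab : adj a b)
    (mmw_G : 3 <= mmw G) :
  3 <= mmw (del_edge a b).
Proof.
(* With no decomposition, [mmw G] would be 0. *)
have [D] : inhabited (branch_decomp G).
  by move: mmw_G; rewrite /mmw; case: pselect => // ex _; case: ex => k /asboolP[].
(* [D'] is optimal for the smaller graph; its width there is at least its width in [G], hence at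
   least [mmw G]. *)
have [D' <-] := @mmw_attained (del_edge a b) D.
apply: leq_trans mmw_G (leq_trans (@mmw_le_width G D') _).
exact: bd_width_del_edge neigh_c.
Qed.
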